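(* Let $\mathcal H$ be an infinite-dimensional complex Hilbert space with inner product $\langle\cdot,\cdot\rangle$ (conjugate-linear in the first, linear in the second argument), and let $\mathcal D\subset\mathcal H$ be a dense linear subspace such that $(\mathcal D,t)$ is an (F)-space, where $t$ is the graph topology defined below. Let $\mathcal F(\mathcal D)$ be the set of finite-rank operators in $\mathcal L^+(\mathcal D)$, i.e. the linear span of the operators $\phi\otimes\psi$, $\phi,\psi\in\mathcal D$, where $(\phi\otimes\psi)\chi=\langle\psi,\chi\rangle\phi$ for $\chi\in\mathcal D$. Suppose that $\Phi\colon\mathcal F(\mathcal D)\to\mathcal F(\mathcal D)$ is an additive surjective mapping preserving projections of rank one and their linear spans, i.e. for every rank-one projection $P\in\mathcal F(\mathcal D)$, $\Phi(P)$ is a rank-one projection and $\Phi(\mathbb C P)\subset\mathbb C\,\Phi(P)$. Then one of the following holds: (i) $\Phi(T)=ATA^{-1}$ for all $T\in\mathcal F(\mathcal D)$, where $A\colon\mathcal D\to\mathcal D$ is a bijective operator which is either linear or conjugate-linear; or (ii) $\Phi(T)=CT^+C^{-1}$ for all $T\in\mathcal F(\mathcal D)$, where $C\colon\mathcal D\to\mathcal D$ is a bijective operator which is either linear or conjugate-linear. Moreover, if the operator $A$ (resp. $C$) is linear, then it belongs to $\mathcal L^+(\mathcal D)$.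
   Context: $\mathcal L^+(\mathcal D)$ denotes the *-algebra of all linear operators $A$ (defined on $\mathcal D$) with $A\mathcal D\subset\mathcal D$ and $A^*\mathcal D\subset\mathcal D$ (in particular $\mathcal D\subset\mathcal D(A^* )$), with involution $A\mapsto A^+:=A^*|_{\mathcal D}$. The graph topology $t$ on $\mathcal D$ is the locally convex topology generated by the seminorms $\phi\mapsto\|A\phi\|$, $A\in\mathcal L^+(\mathcal D)$. A projection means an idempotent operator ($P^2=P$); a rank-one projection in $\mathcal F(\mathcal D)$ is thus an operator $\phi\otimes\psi$ with $\langle\psi,\phi\rangle=1$. For $T\in\mathcal F(\mathcal D)$, $T^+=T^*|_{\mathcal D}$. *)

(* Defs.v *)
From HB Require Import structures.
From mathcomp Require Import all_boot all_order all_algebra.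
From mathcomp Require Import reals.
From mathcomp Require Import complex.
Set Implicit Arguments. Unset Strict Implicit. Unset Printing Implicit Defensive.
Import Order.TTheory GRing.Theory Num.Theory.
Local Open Scope ring_scope.

Section Defs.
Variable R : realType.
Local Notation C := (R[i]).

Section Hilbert.
Variable H : lmodType C.
Variable ip : H -> H -> C.

Definition normH (x : H) : R := Num.sqrt (complex.Re (ip x x)).

Definition is_hilbert : Prop :=
  [/\ (forall (a : C) (x y z : H), ip x (a *: y + z) = a * ip x y + ip x z),
      (forall x y : H, ip y x = conjc (ip x y)),
      (forall x : H, 0 <= ip x x),
      (forall x : H, ip x x = 0 -> x = 0) &
      (forall u : nat -> H,
         (forall e : R, 0 < e -> exists N, forall m n, (N <= m)%N -> (N <= n)%N ->
             normH (u m - u n) < e) ->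
         exists l : H, forall e : R, 0 < e -> exists N, forall n, (N <= n)%N ->
             normH (u n - l) < e)].

Definition infinite_dim : Prop :=
  forall (n : nat) (v : 'I_n -> H), exists x : H,
    forall c : 'I_n -> C, x <> \sum_(i < n) c i *: v i.

(* ---------- the dense subspace D, given as an injective linear map D -> H ---- *)
Variable D : lmodType C.
Variable iota : D -> H.

Definition is_dense_subspace : Prop :=
  [/\ (forall (a : C) (x y : D), iota (a *: x + y) = a *: iota x + iota y),
      injective iota &
      (forall (x : H) (e : R), 0 < e -> exists d : D, normH (x - iota d) < e)].

Definition ipD (x y : D) : C := ip (iota x) (iota y).

Definition op := D -> D.

Definition linear_op (A : op) : Prop :=
  forall (a : C) (x y : D), A (a *: x + y) = a *: A x + A y.

Definition antilinear_op (A : op) : Prop :=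
  forall (a : C) (x y : D), A (a *: x + y) = conjc a *: A x + A y.

(* [Ap] is A^+ = A^*|_D : <Ap phi, psi> = <phi, A psi> for phi, psi in D
   (this says exactly that D is in the domain of A^* and A^* phi = Ap phi) *)
Definition is_plus (A Ap : op) : Prop :=
  forall phi psi : D, ipD (Ap phi) psi = ipD phi (A psi).

Definition in_Lplus (A : op) : Prop :=
  linear_op A /\ exists Ap : op, is_plus A Ap.

Definition tens (phi psi : D) : op := fun chi => ipD psi chi *: phi.

Definition in_F (T : op) : Prop :=
  exists (n : nat) (c : 'I_n -> C) (phi psi : 'I_n -> D),
    T = fun chi => \sum_(i < n) c i *: tens (phi i) (psi i) chi.

Definition rank1_proj (P : op) : Prop :=
  [/\ in_F P, (forall x, P (P x) = P x),
      exists x, P x <> 0 &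
      exists phi : D, forall x, exists c : C, P x = c *: phi].

Definition op_add (S T : op) : op := fun x => S x + T x.
Definition op_scale (c : C) (T : op) : op := fun x => c *: T x.

Definition sn (A : op) (x : D) : R := normH (iota (A x)).

Definition t_open (U : D -> Prop) : Prop :=
  forall x, U x -> exists (n : nat) (As : 'I_n -> op) (e : R),
    [/\ 0 < e, (forall i, in_Lplus (As i)) &
        forall y, (forall i, sn (As i) (y - x) < e) -> U y].

Definition is_metric (d : D -> D -> R) : Prop :=
  [/\ (forall x y, 0 <= d x y), (forall x y, d x y = 0 <-> x = y),
      (forall x y, d x y = d y x) &
      (forall x y z, d x z <= d x y + d y z)].

Definition d_open (d : D -> D -> R) (U : D -> Prop) : Prop :=
  forall x, U x -> exists e : R, 0 < e /\ forall y, d x y < e -> U y.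

(* (D,t) is an (F)-space: metrizable and complete (for a metrizable
   topological vector space, sequential completeness w.r.t. the uniform
   structure given by the seminorms) *)
Definition is_Fspace : Prop :=
  (exists d : D -> D -> R, is_metric d /\ forall U, t_open U <-> d_open d U) /\
  (forall u : nat -> D,
     (forall A, in_Lplus A -> forall e : R, 0 < e -> exists N, forall m n,
         (N <= m)%N -> (N <= n)%N -> sn A (u m - u n) < e) ->
     exists l : D, forall A, in_Lplus A -> forall e : R, 0 < e ->
       exists N, forall n, (N <= n)%N -> sn A (u n - l) < e).

End Hilbert.
End Defs.

(* Main.v *)
Require Import Defs.
From HB Require Import structures.
From mathcomp Require Import all_boot all_order all_algebra.
From mathcomp Require Import reals complex.
From mathcomp Require Import boolp ring lra.
Import Order.TTheory GRing.Theory Num.Theory.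
Local Open Scope ring_scope.

(** Put [tau x y := Phi (x (x) y)].  If [P] and [N] are such that [P], [P + N]
    and [P + 2 N] are rank-one projections, then [N] has rank at most one, so
    [tau] is a biadditive map into the operators of rank at most one.  Families
    of such operators whose pairwise sums have rank at most one share a range or
    a kernel, and surjectivity of [Phi] rules out the degenerate cases, whence
    [tau x y = A x (x) B y] or [tau x y = B y (x) A x] with [A], [B] additive;
    exchanging the arguments of [tau] turns the second case into the first.
    Since [Phi] preserves the lines spanned by projections, [A] is semilinear
    for some ring endomorphism [h] of the complex field, and idempotency gives
    [<B y, A x> = h <y, x>]; [h] is onto because [Phi] is.

    It remains to see that [h] is bounded near [0], hence the identity or the
    conjugation.  Otherwise take an orthogonal sequence [e_n] in [D] and
    scalars [c_n] so small that [l = sum c_n e_n] converges in the Frechet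
    space [D], yet [n |B y_n| < |h c_n|] where [y_n = e_n / |e_n|^2].  Then
    [h c_n = <B y_n, A l>] contradicts the Cauchy-Schwarz inequality.  Finally
    [<B y, A x> = <y, x>] for linear [A] exhibits the adjoint of [A] as the
    inverse of [B]. *)

Set Implicit Arguments.
Unset Strict Implicit.
Unset Printing Implicit Defensive.

(** * Additive maps and lines *)

Section AdditiveMaps.
Variables (U W : zmodType) (f : U -> W).
Hypothesis fD : {morph f : x y / x + y}.

Lemma morph_add0 : f 0 = 0.
Proof. by apply: (addrI (f 0)); rewrite -fD !addr0. Qed.

Lemma morph_addN x : f (- x) = - f x.
Proof. by apply: (addrI (f x)); rewrite -fD !subrr morph_add0. Qed.

Lemma morph_addB x y : f (x - y) = f x - f y.
Proof. by rewrite fD morph_addN. Qed.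

Lemma morph_add_sum n (F : 'I_n -> U) : f (\sum_i F i) = \sum_i f (F i).
Proof. exact: (big_morph f fD morph_add0). Qed.

End AdditiveMaps.

(** No group is the union of two proper subgroups: if [x] escapes [P] and [y] escapes [Q], then
    [x + y] escapes both. *)
Lemma subgroup_cover (U : zmodType) (P Q : U -> Prop) :
  (forall x y, P x -> P y -> P (x - y)) -> (forall x y, Q x -> Q y -> Q (x - y)) ->
  (forall x, P x \/ Q x) -> (forall x, P x) \/ (forall x, Q x).
Proof.
move=> hP hQ cover; case: (pselect (forall x, P x)) => [|/existsNP[x nPx]]; first by left.
right; apply: contrapT => /existsNP[y nQy].
have Qx : Q x by case: (cover x).
have Py : P y by case: (cover y).
case: (cover (x + y)) => [Pxy|Qxy].
  by apply: nPx; rewrite -(addrK y x); apply: hP.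
by apply: nQy; rewrite -(addrK x y) [y + x]addrC; apply: hQ.
Qed.

Section Lines.
Variables (K : fieldType) (V : lmodType K).
Implicit Types (v w u : V).

Definition line v w := exists k : K, w = k *: v.
(** Linear dependence of the two vectors; the disjunct [v = 0] makes the relation symmetric, which
    [line] is not. *)
Definition par v w := v = 0 \/ line v w.

Lemma lineB v w w' : line v w -> line v w' -> line v (w - w').
Proof. by move=> [k ->] [l ->]; exists (k - l); rewrite scalerBl. Qed.

Lemma line0 v : line v 0.
Proof. by exists 0; rewrite scale0r. Qed.

Lemma lineZ v w k : line v w -> line v (k *: w).
Proof. by move=> [l ->]; exists (k * l); rewrite scalerA. Qed.

Lemma par_sym v w : par v w -> par w v.
Proof.
case=> [->|[k ->]]; first by right; exists 0; rewrite scale0r.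
have [->|k0] := eqVneq k 0; first by left; rewrite scale0r.
by right; exists k^-1; rewrite scalerA mulVf // scale1r.
Qed.

Lemma par_line v w : v != 0 -> par v w -> line v w.
Proof. by move=> v0 [v0'|//]; rewrite v0' eqxx in v0. Qed.

Lemma par_trans u v w : v != 0 -> par u v -> par v w -> par u w.
Proof.
move=> v0 uv vw; have [l ->] := par_line v0 vw.
by case: uv => [->|[k ->]]; [left | right; exists (l * k); rewrite scalerA].
Qed.

Lemma par_scale (s t : K) u : par (s *: u) (t *: u).
Proof.
have [->|s0] := eqVneq s 0; first by left; rewrite scale0r.
by right; exists (t / s); rewrite scalerA divfK.
Qed.

Lemma notline_neq0 v w : ~ line v w -> w != 0.
Proof. by move=> nl; apply/eqP => w0; apply: nl; rewrite w0; apply: line0. Qed.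

(* Two independent values [f x], [f y] pin down a single ratio, which then
   propagates to every other vector. *)
Lemma locally_dependent (f g : V -> V) :
  {morph f : x y / x + y} -> {morph g : x y / x + y} ->
  (forall x, par (f x) (g x)) -> ~ (exists u, forall x, line u (f x)) ->
  exists k, forall x, g x = k *: f x.
Proof.
move=> fD gD fg nl.
have step x y k : f x != 0 -> ~ line (f x) (f y) -> g x = k *: f x -> g y = k *: f y.
  move=> fx0 nxy gx.
  have fy0 := notline_neq0 nxy.
  have [m gy] := par_line fy0 (fg y).
  have fxy0 : f (x + y) != 0.
    apply/eqP; rewrite fD => /eqP; rewrite addrC addr_eq0 => /eqP e.
    by apply: nxy; exists (-1); rewrite e scaleN1r.
  have [l] := par_line fxy0 (fg (x + y)); rewrite gD fD gx gy => e.
  have e' : (m - l) *: f y = (l - k) *: f x.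
    apply/eqP; rewrite !scalerBl subr_eq addrAC eq_sym subr_eq.
    by rewrite -scalerDr -e addrC.
  have [ml|ml] := eqVneq m l.
    move: e'; rewrite ml subrr scale0r => /esym/eqP.
    by rewrite scaler_eq0 (negbTE fx0) orbF subr_eq0 => /eqP ->.
  case: nxy; exists ((m - l)^-1 * (l - k)).
  by rewrite -scalerA -e' scalerA mulVf ?subr_eq0 // scale1r.
have [x fx0] : exists x, f x != 0.
  apply: contrapT => h; apply: nl; exists 0 => x.
  have -> : f x = 0 by apply: contrapT => /eqP fx; apply: h; exists x.
  exact: line0.
have [k gx] := par_line fx0 (fg x).
have [x' nx'] : exists x', ~ line (f x) (f x').
  by apply/existsNP => h; apply: nl; exists (f x).
exists k => z.
(* When [f z] lies on the line of [f x], [step] reaches [z + x'] and [x'] instead, and the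
   difference gives [z]. *)
case: (pselect (line (f x) (f z))) => [lz|nz]; last exact: (step x).
have : ~ line (f x) (f (z + x')).
  by move=> l; apply: nx'; have := lineB l lz; rewrite fD addrC addKr.
move/(step _ _ _ fx0) => /(_ _ gx); rewrite gD fD scalerDr (step x x' k) //.
exact: addIr.
Qed.

End Lines.

(** * Operators of rank at most one *)

(** The algebraic half of [is_hilbert], shared by [H] and the possibly incomplete space [D]. *)
Definition inner_product (R : realType) (V : lmodType R[i]) (q : V -> V -> R[i]) :=
  [/\ forall (a : R[i]) x y z, q x (a *: y + z) = a * q x y + q x z,
      forall x y, q y x = conjc (q x y),
      forall x, 0 <= q x x & forall x, q x x = 0 -> x = 0].

Section InnerProduct.
Variables (R : realType) (V : lmodType R[i]) (q : V -> V -> R[i]).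
Hypothesis hq : inner_product q.
Implicit Types (x y z u v w a b : V) (c k : R[i]).

Lemma ip_conj x y : q y x = conjc (q x y).
Proof. by case: hq. Qed.

Lemma ipDr x y z : q x (y + z) = q x y + q x z.
Proof. by case: hq => l _ _ _; have := l 1 x y z; rewrite scale1r mul1r. Qed.

Lemma ip0r x : q x 0 = 0.
Proof. exact: (morph_add0 (ipDr x)). Qed.

Lemma ipZr c x y : q x (c *: y) = c * q x y.
Proof. by case: hq => l _ _ _; have := l c x y 0; rewrite !addr0 ip0r addr0. Qed.

Lemma ipBr x y z : q x (y - z) = q x y - q x z.
Proof. exact: (morph_addB (ipDr x)). Qed.

Lemma ip_sumr x n (F : 'I_n -> V) : q x (\sum_i F i) = \sum_i q x (F i).
Proof. exact: (morph_add_sum (ipDr x)). Qed.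

Lemma ipDl x y z : q (x + y) z = q x z + q y z.
Proof. by rewrite !(ip_conj z) ipDr rmorphD. Qed.

Lemma ip0l x : q 0 x = 0.
Proof. by rewrite ip_conj ip0r conjc0. Qed.

Lemma ipZl c x y : q (c *: x) y = conjc c * q x y.
Proof. by rewrite !(ip_conj y) ipZr rmorphM. Qed.

Lemma ipBl x y z : q (x - y) z = q x z - q y z.
Proof. by rewrite !(ip_conj z) ipBr rmorphB. Qed.

Lemma ip_ge0 x : 0 <= q x x.
Proof. by case: hq. Qed.

Lemma ip_eq0 x : (q x x == 0) = (x == 0).
Proof.
by apply/eqP/eqP => [|->]; [case: hq => _ _ _; apply | rewrite ip0r].
Qed.

Lemma ip_inj x y : (forall z, q x z = q y z) -> x = y.
Proof.
by move=> h; apply/eqP; rewrite -subr_eq0 -ip_eq0 ipBl h subrr.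
Qed.

Lemma ip_normalize x : x != 0 -> exists y, q x y = 1.
Proof.
move=> x0; exists ((q x x)^-1 *: x).
by rewrite ipZr mulVf // ip_eq0.
Qed.

Lemma ip1_neq0 x y : q x y = 1 -> y != 0.
Proof.
by move=> xy; apply: contraTneq (oner_neq0 R[i]) => y0; rewrite -xy y0 ip0r eqxx.
Qed.

(** The component of [w] orthogonal to [v] is nonzero off the line of [v], and a multiple of it
    serves. *)
Lemma separate v w : ~ line v w -> exists x, q v x = 0 /\ q w x = 1.
Proof.
move=> nl.
have [v0|v0] := eqVneq v 0.
  have [x wx] := ip_normalize (notline_neq0 nl).
  by exists x; rewrite v0 ip0l.
pose w' := w - (q v w / q v v) *: v.
have qv : q v w' = 0 by rewrite ipBr ipZr divfK ?subrr // ip_eq0.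
have w'0 : w' != 0.
  by rewrite subr_eq0; apply/eqP => e; apply: nl; rewrite e; exists (q v w / q v v).
exists ((q w' w')^-1 *: w'); rewrite !ipZr qv mulr0; split=> //.
have -> : q w w' = q w' w'.
  by rewrite [in RHS]/w' ipBl ipZl qv mulr0 subr0.
by rewrite mulVf // ip_eq0.
Qed.

Definition dyad a b : V -> V := fun x => q b x *: a.

Definition rank_le1 (T : V -> V) := exists a b, T = dyad a b.

Lemma dyadZ k a b : dyad (k *: a) b = dyad a (conjc k *: b).
Proof. by apply/funext => x; rewrite /dyad ipZl conjcK scalerA mulrC. Qed.

Lemma dyad0l b : dyad 0 b = fun=> 0.
Proof. by apply/funext => x; rewrite /dyad scaler0. Qed.

Lemma dyad0r a : dyad a 0 = fun=> 0.
Proof. by apply/funext => x; rewrite /dyad ip0l scale0r. Qed.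

Lemma line_dyadr v b a : line v b -> exists a', dyad a b = dyad a' v.
Proof.
by move=> [k ->]; exists (conjc k *: a); rewrite dyadZ conjcK.
Qed.

Lemma line_dyadl u a b : line u a -> exists b', dyad a b = dyad u b'.
Proof. by move=> [k ->]; exists (conjc k *: b); rewrite dyadZ. Qed.

Lemma dyadDl a a' b : (fun x => dyad a b x + dyad a' b x) = dyad (a + a') b.
Proof. by apply/funext => x; rewrite /dyad scalerDr. Qed.

Lemma dyadDr a b b' : (fun x => dyad a b x + dyad a b' x) = dyad a (b + b').
Proof. by apply/funext => x; rewrite /dyad ipDl scalerDl. Qed.

Lemma dyad_adj a b x y : q y (dyad b a x) = conjc (q x (dyad a b y)).
Proof. by rewrite /dyad !ipZr rmorphM (ip_conj b y) (ip_conj x a) mulrC. Qed.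

(** By [dyad_adj] the adjoint of [dyad a b] is [dyad b a], and taking adjoints is additive. *)
Lemma dyad_swapD a b a' b' a'' b'' :
  (forall x, dyad a b x = dyad a' b' x + dyad a'' b'' x) ->
  forall x, dyad b a x = dyad b' a' x + dyad b'' a'' x.
Proof.
move=> h x; apply: ip_inj => z; rewrite ip_conj [RHS]ip_conj.
by rewrite ipDr !(dyad_adj _ _ x z) h ipDr rmorphD.
Qed.

(** If [b] and [b'] are independent, vectors dual to them show that [a] and [a'] both lie in the
    range of the sum, which is spanned by [c]. *)
Lemma rank_le1_add a b a' b' :
  rank_le1 (fun x => dyad a b x + dyad a' b' x) -> par a a' \/ par b b'.
Proof.
move=> [c [d h]].
case: (pselect (par b b')) => [|nbb']; [by right | left].
have [x [bx b'x]] : exists x, q b x = 0 /\ q b' x = 1.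
  by apply: separate => l; apply: nbb'; right.
have [x' [b'x' bx']] : exists x, q b' x = 0 /\ q b x = 1.
  by apply: separate => l; apply: nbb'; apply: par_sym; right.
have := congr1 (@^~ x) h; have := congr1 (@^~ x') h.
rewrite /dyad bx b'x bx' b'x' !scale1r !scale0r add0r addr0 => -> ->.
exact: par_scale.
Qed.

Lemma par_rank_le1_add a b a' b' :
  par a a' \/ par b b' -> rank_le1 (fun x => dyad a b x + dyad a' b' x).
Proof.
case=> [[->|/(line_dyadl b')[c ->]]|[->|/(line_dyadr a')[c ->]]].
- by rewrite dyad0l; exists a', b'; apply/funext => x; rewrite add0r.
- by exists a, (b + c); rewrite -dyadDr.
- by rewrite dyad0r; exists a', b'; apply/funext => x; rewrite add0r.
- by exists (a + c), b; rewrite -dyadDl.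
Qed.

(** Otherwise some [f i] does not factor through [v] and some [f j] does not have range in the line
    of [u], where [f i0 = dyad u v]. Comparison with [f i0] leaves [f i] only the range of [u] and
    [f j] only the functional [v], so [f i + f j] has rank two. *)
Lemma rank_le1_clique (I : Type) (f : I -> V -> V) :
  (forall i, rank_le1 (f i)) ->
  (forall i j, rank_le1 (fun x => f i x + f j x)) ->
  (exists v, forall i, exists a, f i = dyad a v) \/
  (exists u, forall i, exists b, f i = dyad u b).
Proof.
move=> hf hadd; apply: contrapT => /not_orP[/forallNP nl /forallNP nr].
have nzl i v a b : ~ (exists a, f i = dyad a v) -> f i = dyad a b -> a != 0 /\ b != 0.
  by move=> n e; split; apply/eqP => z; apply: n; exists 0; rewrite e z ?dyad0r !dyad0l.
have nzr i u a b : ~ (exists b, f i = dyad u b) -> f i = dyad a b -> a != 0 /\ b != 0.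
  by move=> n e; split; apply/eqP => z; apply: n; exists 0; rewrite e z ?dyad0l !dyad0r.
(* A common functional [0] would mean that all [f i] vanish, so this picks a nonzero member. *)
have [i0 ni0] := (existsNP _).2 (nl 0).
have [u [v fi0]] := hf i0; have [u0 v0] := nzl _ _ _ _ ni0 fi0.
have [i ni] := (existsNP _).2 (nl v).
have [a [b fi]] := hf i; have [a0 b0] := nzl _ _ _ _ ni fi.
have nvb : ~ par v b.
  by move=> /(par_line v0)/(line_dyadr a)[c e]; apply: ni; exists c; rewrite fi.
have [j nj] := (existsNP _).2 (nr u).
have [a' [b' fj]] := hf j; have [a'0 b'0] := nzr _ _ _ _ nj fj.
have nua : ~ par u a'.
  by move=> /(par_line u0)/(line_dyadl b')[c e]; apply: nj; exists c; rewrite fj.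
have ua : par u a.
  by have := hadd i0 i; rewrite fi0 fi => /rank_le1_add[].
have vb' : par v b'.
  by have := hadd i0 j; rewrite fi0 fj => /rank_le1_add[].
have := hadd i j; rewrite fi fj => /rank_le1_add[aa'|bb'].
  by apply: nua; apply: par_trans aa'.
by apply: nvb; apply: (par_trans b'0) => //; apply: par_sym.
Qed.

Lemma dyad_both (I : Type) (f : I -> V -> V) u v :
  (forall i, exists a, f i = dyad a v) -> (forall i, exists b, f i = dyad u b) ->
  forall i, exists k, f i = dyad (k *: u) v.
Proof.
move=> fl fr i; have [a fa] := fl i; have [b fb] := fr i.
have [v0|v0] := eqVneq v 0.
  by exists 0; rewrite fa v0 !dyad0r.
have [x vx] := ip_normalize v0.
exists (q b x); rewrite fa; congr (dyad _ v).
by have := congr1 (@^~ x) fb; rewrite fa /dyad vx scale1r.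
Qed.

End InnerProduct.

(** * Biadditive maps of rank at most one *)

Section Biadditive.
Variables (R : realType) (V : lmodType R[i]) (q : V -> V -> R[i]).
Hypothesis hq : inner_product q.
Local Notation dy := (dyad q).
Local Notation rank_le1 := (rank_le1 q).
Implicit Types (x y z u v w a b c d : V) (k : R[i]).

Lemma dyad_swap a b c d : dy a b = dy c d -> dy b a = dy d c.
Proof.
move=> h; apply/funext => x; apply: (ip_inj hq) => z.
by rewrite (ip_conj hq) [RHS](ip_conj hq) !(dyad_adj hq _ _ x z) h.
Qed.

(** [left] and [right] name the factor that varies: here the functional [v] is common, in
    [right_form] the range vector [u]. *)
Definition left_form (f : V -> V -> V) v := forall x, exists a, f x = dy a v.
Definition right_form (f : V -> V -> V) u := forall x, exists b, f x = dy u b.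

(** A nonzero [v] determines the left factors, so any choice of them is additive; for [v = 0] they
    are arbitrary and the zero map is taken. *)
Lemma left_form_additive (f : V -> V -> V) v :
  (forall x x' z, f (x + x') z = f x z + f x' z) -> left_form f v ->
  exists A : V -> V, {morph A : x y / x + y} /\ forall x, f x = dy (A x) v.
Proof.
move=> fD fv; have [v0|v0] := eqVneq v 0.
  exists (fun=> 0); split=> [x y|x]; first by rewrite addr0.
  by have [a ->] := fv x; rewrite v0 !(dyad0r hq).
have [A fA] := choice fv; exists A; split=> // x y.
have [z vz] := ip_normalize hq v0.
by have := fD x y z; rewrite !fA /dyad vz !scale1r.
Qed.

Lemma right_form_additive (f : V -> V -> V) u :
  (forall x x' z, f (x + x') z = f x z + f x' z) -> right_form f u ->
  exists B : V -> V, {morph B : x y / x + y} /\ forall x, f x = dy u (B x).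
Proof.
move=> fD fu; have [u0|u0] := eqVneq u 0.
  exists (fun=> 0); split=> [x y|x]; first by rewrite addr0.
  by have [a ->] := fu x; rewrite u0 !dyad0l.
have [B fB] := choice fu; exists B; split=> // x y; apply: (ip_inj hq) => z.
apply/eqP; rewrite -subr_eq0.
have := fD x y z; rewrite !fB /dyad -scalerDl -(ipDl hq) => /eqP.
by rewrite -subr_eq0 -scalerBl scaler_eq0 (negbTE u0) orbF.
Qed.

Section StrictlyLeft.
Variable tau : V -> V -> V -> V.
Hypothesis tauDl : forall x x' y z, tau (x + x') y z = tau x y z + tau x' y z.
Hypothesis tauDr : forall x y y' z, tau x (y + y') z = tau x y z + tau x y' z.
Hypothesis tau_rank : forall x y, rank_le1 (tau x y).

Lemma left_or_right y :
  (exists v, left_form (tau^~ y) v) \/ (exists u, right_form (tau^~ y) u).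
Proof.
apply: (rank_le1_clique hq) => [x|x x']; first exact: tau_rank.
rewrite (_ : (fun z => _) = tau (x + x') y) //.
by apply/funext => z; rewrite tauDl.
Qed.

Lemma rank_tauDr x y y' a b a' b' :
  tau x y = dy a b -> tau x y' = dy a' b' -> par a a' \/ par b b'.
Proof.
move=> h h'; apply: (rank_le1_add hq).
rewrite (_ : (fun z => _) = tau x (y + y')) //.
by apply/funext => z; rewrite tauDr h h'.
Qed.

(* Nondegeneracy yields [y2] whose right factor is independent of [v1]; every [y] is
   then compared with [y1] or [y2], which forces its left factor to be a multiple
   of [A]. *)
Lemma strictly_left y1 v1 :
  left_form (tau^~ y1) v1 -> ~ (exists u, right_form (tau^~ y1) u) ->
  ~ (exists v, forall x y, exists a, tau x y = dy a v) ->
  exists A B : V -> V, forall x y, tau x y = dy (A x) (B y).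
Proof.
move=> left1 nright1 nleft.
have v10 : v1 != 0.
  apply/eqP => v10; apply: nright1; exists 0 => x; exists 0.
  by have [a ->] := left1 x; rewrite v10 !(dyad0r hq).
have [A [AD tauA]] := left_form_additive (fun x x' => tauDl x x' y1) left1.
have nlineA u : ~ forall x, line u (A x).
  move=> l; apply: nright1; exists u => x.
  by have [b e] := line_dyadl hq v1 (l x); exists b; apply: etrans (tauA x) e.
(* If [tau^~ y] had a common range vector [u], comparison with [y1] would put each [A x] on the line
   of [u] or each [B x] on the line of [v1], by [subgroup_cover]; [nlineA] excludes the first. *)
have left y : exists v, left_form (tau^~ y) v.
  case: (left_or_right y) => // -[u ru].
  have [u0|u0] := eqVneq u 0.
    by exists 0 => x; exists 0; have [b ->] := ru x; rewrite u0 !dyad0l.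
  have [B [BD tauB]] := right_form_additive (fun x x' => tauDl x x' y) ru.
  have cover x : line u (A x) \/ line v1 (B x).
    case: (rank_tauDr (tauA x) (tauB x)) => p; [left | right].
      by apply: (par_line u0); apply: par_sym.
    exact: par_line p.
  case: (@subgroup_cover _ _ _ _ _ cover) => [x x'|x x'|/nlineA //|l].
  - by rewrite (morph_addB AD); apply: lineB.
  - by rewrite (morph_addB BD); apply: lineB.
  exists v1 => x.
  by have [a e] := line_dyadr hq u (l x); exists a; apply: etrans (tauB x) e.
have repr y : exists v (A' : V -> V),
    {morph A' : x y / x + y} /\ forall x, tau x y = dy (A' x) v.
  have [v lv] := left y; exists v.
  exact: (left_form_additive (fun x x' => tauDl x x' y)).
have prop y v (A' : V -> V) y' v' :
    (forall x, tau x y' = dy (A x) v') -> {morph A' : x y / x + y} ->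
    (forall x, tau x y = dy (A' x) v) -> v' != 0 -> ~ par v' v ->
    exists k, forall x, A' x = k *: A x.
  move=> t' A'D t v'0 nvv'; apply: locally_dependent => // [x|[u /nlineA]] //.
  by case: (rank_tauDr (t' x) (t x)).
have [x2 [y2 n2]] : exists x2 y2, ~ exists a, tau x2 y2 = dy a v1.
  have [x2 /existsNP[y2 n2]] := (existsNP _).2 (fun h => nleft (ex_intro _ v1 h)).
  by exists x2, y2.
have [v2 [A2 [A2D tauA2]]] := repr y2.
have n12 : ~ par v1 v2.
  move/(par_line v10)/(line_dyadr hq (A2 x2)) => [c e].
  by apply: n2; exists c; rewrite tauA2.
have [k2 A2E] := prop _ _ _ _ _ tauA A2D tauA2 v10 n12.
have k20 : k2 != 0.
  by apply/eqP => k0; apply: n2; exists 0; rewrite tauA2 A2E k0 scale0r !dyad0l.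
(* The scalar [k2] moves, conjugated, to the right factor, so that [y1] and [y2] share the left
   factor [A]. *)
have n12' : ~ par v1 (conjc k2 *: v2).
  move/(par_line v10) => [c e]; apply: n12; right; exists ((conjc k2)^-1 * c).
  by rewrite -scalerA -e scalerA mulVf ?scale1r // conjc_eq0.
have tau2 x : tau x y2 = dy (A x) (conjc k2 *: v2).
  by rewrite tauA2 A2E (dyadZ hq).
have v2'0 : conjc k2 *: v2 != 0.
  by apply/eqP => e; apply: n12'; rewrite e; right; apply: line0.
have tensor y : exists b, forall x, tau x y = dy (A x) b.
  have [v [A' [A'D tauA']]] := repr y.
  have [v0|v0] := eqVneq v 0.
    by exists 0 => x; rewrite tauA' v0 !(dyad0r hq).
  suff [k A'E] : exists k, forall x, A' x = k *: A x.
    by exists (conjc k *: v) => x; rewrite tauA' A'E (dyadZ hq).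
  case: (pselect (par v1 v)) => [p1|]; last exact: prop tauA A'D tauA' v10.
  apply: (prop _ _ _ _ _ tau2 A'D tauA' v2'0) => p2.
  by apply: n12'; apply: (par_trans v0 p1); apply: par_sym.
have [B tauB] := choice tensor.
by exists A, B.
Qed.

End StrictlyLeft.

Section TensorForm.
Variable tau : V -> V -> V -> V.
Hypothesis tauDl : forall x x' y z, tau (x + x') y z = tau x y z + tau x' y z.
Hypothesis tauDr : forall x y y' z, tau x (y + y') z = tau x y z + tau x y' z.
Hypothesis tau_rank : forall x y, rank_le1 (tau x y).
Hypothesis nleft : ~ exists v, forall x y, exists a, tau x y = dy a v.
Hypothesis nright : ~ exists u, forall x y, exists b, tau x y = dy u b.

(** Pointwise adjoints [sigma] exchange ranges and functionals, which reduces the claim to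
    [strictly_left]. *)
Lemma strictly_right y1 u1 :
  right_form (tau^~ y1) u1 -> ~ (exists v, left_form (tau^~ y1) v) ->
  exists A B : V -> V, forall x y, tau x y = dy (B y) (A x).
Proof.
move=> right1 nleft1.
(* The adjoint is defined through chosen factors; [dyad_swap] shows that it does not depend on the
   choice. *)
have coefs p : exists ab : V * V, tau p.1 p.2 = dy ab.1 ab.2.
  by have [a [b ->]] := tau_rank p.1 p.2; exists (a, b).
have [ab tauE] := choice coefs.
pose sigma x y := dy (ab (x, y)).2 (ab (x, y)).1.
have swap x y a b : sigma x y = dy a b -> tau x y = dy b a.
  by move/dyad_swap => <-; rewrite (tauE (x, y)).
have swap' x y a b : tau x y = dy a b -> sigma x y = dy b a.
  by rewrite (tauE (x, y)) => /dyad_swap.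
have [||||[v hv]|[v hv]|A [B h]] := @strictly_left sigma _ _ _ y1 u1.
- move=> x x' y z; apply: (dyad_swapD hq) => {}z.
  by have := tauDl x x' y z; rewrite !(tauE (_, _)).
- move=> x y y' z; apply: (dyad_swapD hq) => {}z.
  by have := tauDr x y y' z; rewrite !(tauE (_, _)).
- by move=> x y; exists (ab (x, y)).2, (ab (x, y)).1.
- by move=> x; have [b /swap'] := right1 x; exists b.
- by apply: nleft1; exists v => x; have [b /swap] := hv x; exists b.
- by apply: nright; exists v => x y; have [a /swap] := hv x y; exists a.
- by exists A, B => x y; apply: swap.
Qed.

Lemma tensor_form :
  (exists A B : V -> V, forall x y, tau x y = dy (A x) (B y)) \/
  (exists A B : V -> V, forall x y, tau x y = dy (B y) (A x)).
Proof.
case: (pselect (forall y, (exists v, left_form (tau^~ y) v) /\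
                          (exists u, right_form (tau^~ y) u))); last first.
  move=> /existsNP[y ny].
  case: (left_or_right tauDl tau_rank y) => -[w hw].
    left; apply: (strictly_left tauDl tauDr tau_rank hw) => // r.
    by apply: ny; split => //; exists w.
  right; apply: (strictly_right hw) => l.
  by apply: ny; split => //; exists w.
(* In the remaining case the values at all pairs [(x, y)] form one clique, and [rank_le1_clique]
   contradicts [nleft] or [nright]. *)
move=> both; exfalso.
have thin y : exists u v, forall x, exists k, tau x y = dy (k *: u) v.
  have [[v hv] [u hu]] := both y; exists u, v.
  exact: (dyad_both hq hv hu).
have adj (p p' : V * V) : rank_le1 (fun z => tau p.1 p.2 z + tau p'.1 p'.2 z).
  case: p p' => [x y] [x' y'] /=.
  have [u [v tauE]] := thin y; have [u' [v' tauE']] := thin y'.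
  have [k tk] := tauE x; have [k' tk'] := tauE' x'.
  rewrite tk tk'; apply: (par_rank_le1_add hq).
  case: (pselect (exists z, tau z y <> (fun=> 0) /\ tau z y' <> (fun=> 0))).
    move=> [z [nz nz']]; have [l tl] := tauE z; have [l' tl'] := tauE' z.
    case: (rank_tauDr tauDr tau_rank tl tl'); last by right.
    have l0 : l != 0.
      by apply/eqP => l0; apply: nz; rewrite tl l0 scale0r dyad0l.
    have l'0 : l' != 0.
      by apply/eqP => e; apply: nz'; rewrite tl' e scale0r dyad0l.
    case=> [/eqP|[m e]]; last first.
      left; have -> : u' = (l'^-1 * m * l) *: u.
        by rewrite -!scalerA -e scalerA mulVf // scale1r.
      by rewrite scalerA; apply: par_scale.
    rewrite scaler_eq0 (negbTE l0) /= => /eqP ->.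
    by left; left; rewrite scaler0.
  (* Here the zero sets of [tau^~ y] and [tau^~ y'] are subgroups covering [V], so one of these maps
     vanishes identically. *)
  move=> /forallNP none.
  have cover z : tau z y = (fun=> 0) \/ tau z y' = (fun=> 0).
    by have /not_andP[/contrapT|/contrapT] := none z; [left | right].
  have tauB w s s' : tau s w = (fun=> 0) -> tau s' w = (fun=> 0) ->
      tau (s - s') w = (fun=> 0).
    move=> h h'; apply/funext => z.
    have := @morph_addB _ _ (fun s => tau s w z) (fun a b => tauDl a b w z) s s'.
    by rewrite h h' subr0.
  have dyad0 a b : dy a b = (fun=> 0) -> a = 0 \/ b = 0.
    move=> h; have [|b0] := eqVneq b 0; [by right | left].
    have [z bz] := ip_normalize hq b0.
    by have := congr1 (@^~ z) h; rewrite /dyad bz scale1r.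
  case: (@subgroup_cover _ _ _ (tauB y) (tauB y') cover) => [/(_ x)|/(_ x')].
    rewrite tk => /dyad0[->|->]; [left | right]; by left.
  by rewrite tk' => /dyad0[->|->]; [left | right]; right; apply: line0.
case: (@rank_le1_clique _ _ _ hq (V * V)%type (fun p => tau p.1 p.2)) => //.
- by move=> [v hv]; apply: nleft; exists v => x y; exact: (hv (x, y)).
- by move=> [u hu]; apply: nright; exists u => x y; exact: (hu (x, y)).
Qed.

End TensorForm.
End Biadditive.

(** * Preservers of rank-one projections *)

Section Preserver.
Variables (R : realType) (V : lmodType R[i]) (q : V -> V -> R[i]).
Hypothesis hq : inner_product q.
Hypothesis dim2 : forall v : V, exists w, ~ line v w.
Local Notation dy := (dyad q).
Local Notation rank_le1 := (rank_le1 q).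
Implicit Types (x y z u v w a b : V) (k : R[i]).

(* [tau x y] stands for the value of the preserver at the rank-one operator
   [dy x y], so that [tau_sesqui] reflects [dyadZ]. *)
Record preserver (tau : V -> V -> V -> V) : Prop := Preserver {
  tauDl : forall x x' y z, tau (x + x') y z = tau x y z + tau x' y z;
  tauDr : forall x y y' z, tau x (y + y') z = tau x y z + tau x y' z;
  tau_sesqui : forall k x y, tau (k *: x) y = tau x (conjc k *: y);
  tau_proj : forall x y, q y x = 1 -> exists u v, q v u = 1 /\ tau x y = dy u v;
  tau_line : forall k x y, q y x = 1 ->
    exists d : R[i], forall z, tau (k *: x) y z = d *: tau x y z;
  tau_surj : forall a b, exists n (x y : 'I_n -> V),
    forall z, dy a b z = \sum_i tau (x i) (y i) z }.

Lemma preserver_swap tau : preserver tau -> preserver (fun x y => tau y x).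
Proof.
case=> Dl Dr sq pr li su; split=> //.
- by move=> k x y; rewrite sq conjcK.
- by move=> x y yx; apply: pr; rewrite (ip_conj hq) yx conjc1.
- move=> k x y yx; have [|d hd] := li (conjc k) y x.
    by rewrite (ip_conj hq) yx conjc1.
  by exists d => z; rewrite -hd sq conjcK.
- by move=> a b; have [n [x [y e]]] := su a b; exists n, y, x.
Qed.

(* At a vector [x] with [q v x = 0] and [q v1 x = 1], idempotency of [P2 = 2 P1 - P]
   reads [u1 = q v u1 *: u]. *)
Lemma projection_pencil u v u1 v1 u2 v2 :
  q v1 u1 = 1 -> q v2 u2 = 1 ->
  (forall z, dy u2 v2 z = dy u1 v1 z + (dy u1 v1 z - dy u v z)) ->
  rank_le1 (fun z => dy u1 v1 z - dy u v z).
Proof.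
move=> p1 p2 e2.
suff h : par u u1 \/ par v v1.
  rewrite (_ : (fun z => _) = fun z => dy u1 v1 z + dy (- u) v z).
    apply: (par_rank_le1_add hq); case: h => /par_sym h; [left | right] => //.
    by case: h => [->|l]; [left | right; rewrite -scaleN1r; apply: lineZ].
  by apply/funext => z; rewrite /dyad scalerN.
case: (pselect (line v v1)) => [|nl]; first by right; right.
left; right; have [x [vx v1x]] := separate hq nl.
have P2x : dy u2 v2 x = u1 + u1.
  by rewrite e2 /dyad vx v1x scale1r scale0r subr0.
have P2u1 : dy u2 v2 u1 = u1 + (u1 - q v u1 *: u).
  by rewrite e2 /dyad p1 scale1r.
have idem : dy u2 v2 (u1 + u1) = u1 + u1.
  by rewrite -P2x /dyad (ipZr hq) p2 mulr1.
have two (y : V) : y + y = 2 *: y by rewrite scalerDl scale1r.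
move: idem; rewrite two /dyad (ipZr hq) -scalerA -/(dy u2 v2 u1) P2u1.
move=> /scalerI; rewrite pnatr_eq0 => /(_ isT)/eqP.
by rewrite -subr_eq0 addrAC subrr add0r subr_eq0 => /eqP e; exists (q v u1).
Qed.

Section Tau.
Variable tau : V -> V -> V -> V.
Hypothesis ht : preserver tau.

Lemma tau0r x z : tau x 0 z = 0.
Proof. by apply: (@morph_add0 _ _ (fun y => tau x y z)) => y y'; apply: tauDr. Qed.

(** For [q y x] nonzero, [tau_line] reduces to a projection. For [q y x = 0] and [q y w = 1], the
    vectors [w], [x + w] and [x + (x + w)] all form projections with [y], and [projection_pencil]
    applies. *)
Lemma tau_rank x y : rank_le1 (tau x y).
Proof.
have [yx|yx] := eqVneq (q y x) 0; last first.
  have n1 : q y ((q y x)^-1 *: x) = 1 by rewrite (ipZr hq) mulVf.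
  have [u [v [_ e]]] := tau_proj ht n1; have [d hd] := tau_line ht (q y x) n1.
  exists (d *: u), v; apply/funext => z.
  move: (hd z); rewrite scalerA mulfV // scale1r => ->.
  by rewrite e /dyad !scalerA mulrC.
have [y0|y0] := eqVneq y 0.
  by exists 0, 0; apply/funext => z; rewrite y0 tau0r dyad0l.
have [w yw] := ip_normalize hq y0.
have [u [v [_ P0]]] := tau_proj ht yw.
have [|u1 [v1 [p1 P1]]] := tau_proj ht (x := x + w) (y := y).
  by rewrite (ipDr hq) yx add0r.
have [|u2 [v2 [p2 P2]]] := tau_proj ht (x := x + (x + w)) (y := y).
  by rewrite !(ipDr hq) yx !add0r.
have e z : tau x y z = dy u1 v1 z - dy u v z.
  by rewrite -P1 -P0 (tauDl ht) addrK.
rewrite (_ : tau x y = fun z => dy u1 v1 z - dy u v z); last exact/funext.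
apply: (projection_pencil p1 p2) => z.
by rewrite -e -P1 -P2 (tauDl ht) addrC.
Qed.

(** A vector killed by [v] would be killed by all sums of values of [tau], yet these sums include
    [dyad w w] with [w] off the line of [v]. *)
Lemma tau_not_left : ~ exists v, forall x y, exists a, tau x y = dy a v.
Proof.
move=> [v hv]; have [w nl] := dim2 v.
have [x [vx wx]] := separate hq nl.
have [n [s [t e]]] := tau_surj ht w w.
have := e x; rewrite big1 => [|i _]; last first.
  by have [a ->] := hv (s i) (t i); rewrite /dyad vx scale0r.
by rewrite /dyad wx scale1r => w0; apply: nl; rewrite w0; apply: line0.
Qed.

Lemma tau_not_right : ~ exists u, forall x y, exists b, tau x y = dy u b.
Proof.
move=> [u hu]; have [w nl] := dim2 u.
have [x wx] := ip_normalize hq (notline_neq0 nl).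
have [n [s [t e]]] := tau_surj ht w w.
apply: nl; have := e x; rewrite /dyad wx scale1r => ->.
apply: big_ind => [|? ?|i _]; first exact: line0.
  by move=> [k ->] [l ->]; exists (k + l); rewrite scalerDl.
by have [b ->] := hu (s i) (t i); exists (q b x).
Qed.

Lemma tau_tensor :
  (exists A B : V -> V, forall x y, tau x y = dy (A x) (B y)) \/
  (exists A B : V -> V, forall x y, tau x y = dy (B y) (A x)).
Proof.
apply: (tensor_form hq) => [x x' y z|x y y' z|||].
- exact: tauDl.
- exact: tauDr.
- exact: tau_rank.
- exact: tau_not_left.
- exact: tau_not_right.
Qed.

End Tau.

(** [A] is semilinear over [h], and [pair_ip] makes [B] its contragredient, twisted by [h]. *)
Record semilinear_pair (A B : V -> V) (h : R[i] -> R[i]) : Prop := SemilinearPair {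
  pair_hD : {morph h : c d / c + d};
  pair_hM : {morph h : c d / c * d};
  pair_h1 : h 1 = 1;
  pair_AD : {morph A : x y / x + y};
  pair_AZ : forall k x, A (k *: x) = h k *: A x;
  pair_Ainj : injective A;
  pair_Asurj : forall y, exists x, A x = y;
  pair_Bsurj : forall y, exists x, B x = y;
  pair_ip : forall x y, q (B y) (A x) = h (q y x) }.

Lemma preserver_pair tau A B :
  preserver tau -> (forall x y, tau x y = dy (A x) (B y)) ->
  exists h, semilinear_pair A B h.
Proof.
move=> ht tauE.
have nz x y : q y x = 1 -> A x != 0 /\ B y != 0.
  move=> /(tau_proj ht)[u [v [vu]]]; rewrite tauE => e.
  have e' := congr1 (@^~ u) e; rewrite /dyad /= vu scale1r in e'.
  have u0 := ip1_neq0 hq vu.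
  by split; apply: contraNneq u0 => z; rewrite -e' z ?(ip0l hq) ?scale0r ?scaler0.
have nzA x : x != 0 -> A x != 0.
  move=> /(ip_normalize hq)[y xy]; case: (nz x y) => //.
  by rewrite (ip_conj hq) xy conjc1.
have [x0 [y0 yx0]] : exists x y, q y x = 1.
  have [w nl] := dim2 0; have [x wx] := ip_normalize hq (notline_neq0 nl).
  by exists x, w.
have [Ax0 By0] := nz _ _ yx0.
have AD : {morph A : x y / x + y}.
  move=> x x'; have [z Bz] := ip_normalize hq By0.
  by have := tauDl ht x x' y0 z; rewrite !tauE /dyad Bz !scale1r.
have Aline k x : par (A x) (A (k *: x)).
  have [->|xn0] := eqVneq x 0; first by left; apply: morph_add0.
  have [y xy] := ip_normalize hq xn0.
  have yx : q y x = 1 by rewrite (ip_conj hq) xy conjc1.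
  have [d hd] := tau_line ht k yx; right; exists d.
  have [_ By] := nz _ _ yx; have [z Bz] := ip_normalize hq By.
  by have := hd z; rewrite !tauE /dyad Bz !scale1r.
have nlA : ~ exists u, forall x, line u (A x).
  move=> [u hu]; apply: (tau_not_right ht); exists u => x y.
  by rewrite tauE; apply: line_dyadl.
(* [Aline] gives a scalar depending on [x]; as the range of [A] is not in a line,
   [locally_dependent] makes it uniform. *)
have semil k : exists d, forall x, A (k *: x) = d *: A x.
  by apply: locally_dependent => // x y; rewrite scalerDr AD.
have [h AZ] := choice semil.
have hE c d : c *: A x0 = d *: A x0 -> c = d.
  move=> /eqP; rewrite -subr_eq0 -scalerBl scaler_eq0 (negbTE Ax0) orbF subr_eq0.
  by move/eqP.
have hD : {morph h : c d / c + d}.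
  by move=> c d; apply: hE; rewrite -AZ !scalerDl AD !AZ.
have hM : {morph h : c d / c * d}.
  by move=> c d; apply: hE; rewrite -AZ -!scalerA !AZ.
have h1 : h 1 = 1 by apply: hE; rewrite -AZ !scale1r.
(* Both expressions of the projection are evaluated at [u] and at [A x], then paired with [v]. *)
have ip1 x y : q y x = 1 -> q (B y) (A x) = 1.
  move=> /(tau_proj ht)[u [v [vu]]]; rewrite tauE => e.
  have e' z : q (B y) z *: A x = q v z *: u by have := congr1 (@^~ z) e.
  have := e' u; rewrite vu scale1r => u_.
  have u0 := ip1_neq0 hq vu.
  have := e' (A x) => eA.
  have := congr1 (q v) u_; rewrite (ipZr hq) vu => e1.
  have := congr1 (q v) eA; rewrite !(ipZr hq) vu mulr1 => e2.
  have vA0 : q v (A x) != 0.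
    by apply/eqP => z; move: e1; rewrite z mulr0 => /eqP; rewrite eq_sym oner_eq0.
  by apply: (mulIf vA0); rewrite e2 mul1r.
have ipE x y : q (B y) (A x) = h (q y x).
  have [yx|yx] := eqVneq (q y x) 0; last first.
    have n1 : q y ((q y x)^-1 *: x) = 1 by rewrite (ipZr hq) mulVf.
    have := ip1 _ _ n1; rewrite AZ (ipZr hq) => e.
    by rewrite -[RHS]mulr1 -e mulrA -hM mulfV // h1 mul1r.
  have h0 : h 0 = 0 by apply: morph_add0.
  have [y00|yn0] := eqVneq y 0.
    have [z Az] := ip_normalize hq Ax0.
    rewrite yx h0 y00; suff -> : B 0 = 0 by rewrite (ip0l hq).
    apply: (ip_inj hq) => z'; rewrite (ip0l hq).
    have := tau0r ht x0 z'; rewrite tauE /dyad => /eqP.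
    by rewrite scaler_eq0 (negbTE Ax0) orbF => /eqP.
  (* Adding [x'] with [q y x' = 1] makes the orthogonal pair normalised, so [ip1] applies to
     [x + x'] and to [x']. *)
  have [x' yx'] := ip_normalize hq yn0.
  apply: (addIr 1); rewrite yx h0 add0r -{1}(ip1 _ _ yx') -(ipDr hq) -AD.
  by apply: ip1; rewrite (ipDr hq) yx yx' add0r.
have BD : {morph B : x y / x + y}.
  move=> y y'; apply: (ip_inj hq) => z; apply/eqP; rewrite -subr_eq0.
  have := tauDr ht x0 y y' z; rewrite !tauE /dyad -scalerDl -(ipDl hq) => /eqP.
  by rewrite -subr_eq0 -scalerBl scaler_eq0 (negbTE Ax0) orbF.
have BZ k y : B (conjc k *: y) = conjc (h k) *: B y.
  apply: (ip_inj hq) => z; apply/eqP; rewrite -subr_eq0.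
  have := tau_sesqui ht k x0 y; rewrite !tauE AZ (dyadZ hq) => /(congr1 (@^~ z))/eqP.
  by rewrite eq_sym /dyad -subr_eq0 -scalerBl scaler_eq0 (negbTE Ax0) orbF.
(* Expand [dyad (c *: A x0) (B y0)] in values of [tau], apply it to [A x0] and pair with [B y0]:
   each term is a product of two values of [h]. *)
have hsurj c : exists d, h d = c.
  have [n [s [t e]]] := tau_surj ht (c *: A x0) (B y0).
  have := congr1 (q (B y0)) (e (A x0)).
  rewrite /dyad !(ipZr hq) ip1 // mulr1 mul1r (ip_sumr hq) => ->.
  exists (\sum_i q (t i) x0 * q y0 (s i)).
  rewrite (morph_add_sum hD); apply: eq_bigr => i _.
  by rewrite tauE /dyad (ipZr hq) !ipE hM.
exists h; split=> //.
- move=> x x' /eqP; rewrite -subr_eq0 -(morph_addB AD) => /eqP e; apply/eqP.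
  by rewrite -subr_eq0; apply: contraT => /nzA; rewrite e eqxx.
(* Evaluating an expansion of [dyad a a] at [z] writes [a] as a combination of vectors [A (s i)],
   whose coefficients are values of [h]. *)
- move=> a; have [->|a0] := eqVneq a 0; first by exists 0; apply: morph_add0.
  have [z az] := ip_normalize hq a0.
  have [n [s [t e]]] := tau_surj ht a a.
  have [g hg] := choice hsurj.
  exists (\sum_i g (q (B (t i)) z) *: s i); rewrite (morph_add_sum AD).
  have := e z; rewrite /dyad az scale1r => ->; apply: eq_bigr => i _.
  by rewrite AZ hg tauE.
(* Pairing an expansion of [dyad z b] with [b] represents the functional [q b], hence [b], by the
   vectors [B (t i)]. *)
- move=> b; have [->|b0] := eqVneq b 0; first by exists 0; apply: morph_add0.
  have [z bz] := ip_normalize hq b0.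
  have [n [s [t e]]] := tau_surj ht z b.
  have [g hg] := choice hsurj.
  exists (\sum_i conjc (g (q b (A (s i)))) *: t i); rewrite (morph_add_sum BD).
  apply: (ip_inj hq) => y.
  have := congr1 (q b) (e y); rewrite /dyad (ipZr hq) bz mulr1 => ->.
  rewrite (ip_sumr hq) (ip_conj hq) (ip_sumr hq) rmorph_sum /=.
  apply: eq_bigr => i _.
  by rewrite tauE -(ip_conj hq) BZ hg (ipZl hq) conjcK /dyad (ipZr hq) mulrC.
Qed.

End Preserver.

(** * Norms and bounded endomorphisms of the complex field *)

Import Normc.

Section Norm.
Variables (R : realType).
Implicit Types (c z : R[i]).

Lemma normc_sqr z : normc z ^+ 2 = complex.Re (z * conjc z).
Proof.
case: z => a b /=; rewrite sqr_sqrtr ?addr_ge0 ?sqr_ge0 //; ring.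
Qed.

Lemma normc_ge0 z : 0 <= normc z.
Proof. by case: z => a b; apply: sqrtr_ge0. Qed.

Lemma Re_le_normc z : complex.Re z <= normc z.
Proof.
case: z => a b /=; apply: le_trans (ler_norm a) _.
by rewrite -sqrtr_sqr ler_wsqrtr // lerDl sqr_ge0.
Qed.

Lemma normc_real (r : R) : normc (r%:C)%C = `|r|.
Proof. by rewrite /= expr0n addr0 sqrtr_sqr. Qed.

Variables (V : lmodType R[i]) (q : V -> V -> R[i]).
Hypothesis hq : inner_product q.
Implicit Types (x y : V).

Lemma normH_ge0 x : 0 <= normH q x.
Proof. exact: sqrtr_ge0. Qed.

Lemma normH_sqr x : normH q x ^+ 2 = complex.Re (q x x).
Proof. by rewrite sqr_sqrtr //; have := ip_ge0 hq x; rewrite lecE => /andP[]. Qed.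

Lemma ip_self x : q x x = ((normH q x ^+ 2)%:C)%C.
Proof. by rewrite normH_sqr RRe_real // ger0_real // ip_ge0. Qed.

Lemma normH0 : normH q 0 = 0.
Proof. by rewrite /normH (ip0r hq) sqrtr0. Qed.

Lemma normHZ c x : normH q (c *: x) = normc c * normH q x.
Proof.
apply/eqP; rewrite -(eqrXn2 (n := 2)) // ?mulr_ge0 ?normH_ge0 ?normc_ge0 //.
rewrite exprMn normc_sqr normH_sqr (ipZr hq) (ipZl hq) mulrA ip_self.
by case: c => a b /=; apply/eqP; ring.
Qed.

(** The vector [q y y *: x - q y x *: y] is a division-free multiple of the component of [x]
    orthogonal to [y]; its square is nonnegative. *)
Lemma cauchy_schwarz x y : normc (q x y) <= normH q x * normH q y.
Proof.
rewrite -(ler_pXn2r (n := 2)) ?nnegrE ?mulr_ge0 ?normH_ge0 ?normc_ge0 //.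
rewrite exprMn normc_sqr -(ip_conj hq).
have [->|y0] := eqVneq y 0.
  by rewrite (ip0r hq) (ip0l hq) mul0r normH0 expr0n mulr0.
have b0 : 0 < q y y by rewrite lt_def (ip_eq0 hq) y0 (ip_ge0 hq).
have := ip_ge0 hq (q y y *: x - q y x *: y).
have -> : q (q y y *: x - q y x *: y) (q y y *: x - q y x *: y)
    = q y y * (q x x * q y y - q x y * q y x).
  rewrite (ipBr hq) !(ipBl hq) !(ipZr hq) !(ipZl hq) -!(ip_conj hq).
  ring.
rewrite pmulr_rge0 // !ip_self -rmorphM subr_ge0 lecE => /andP[_].
by [].
Qed.

Lemma normHD x y : normH q (x + y) <= normH q x + normH q y.
Proof.
rewrite -(ler_pXn2r (n := 2)) ?nnegrE ?addr_ge0 ?normH_ge0 //.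
rewrite sqrrD normH_sqr (ipDr hq) !(ipDl hq) !ip_self.
have Re_ip u v : complex.Re (q u v) <= normH q u * normH q v.
  exact: le_trans (Re_le_normc _) (cauchy_schwarz u v).
have := Re_ip x y; have := Re_ip y x.
rewrite !raddfD /=; lra.
Qed.

End Norm.

Section FieldHom.
Variables (R : realType) (h : R[i] -> R[i]).
Hypothesis hD : {morph h : c d / c + d}.
Hypothesis hM : {morph h : c d / c * d}.
Hypothesis h1 : h 1 = 1.

Lemma field_hom_int (m : int) : h m%:~R = m%:~R.
Proof.
have hn (n : nat) : h n%:R = n%:R.
  by elim: n => [|n IH]; [apply: morph_add0 | rewrite -natr1 hD IH h1].
by case: m => n; rewrite ?NegzE ?mulrNz ?(morph_addN hD) -?pmulrn hn.
Qed.

Lemma bounded_field_hom (e M : R) : 0 < e ->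
  (forall c, normc c <= e -> normc (h c) <= M) ->
  (forall c, h c = c) \/ (forall c, h c = conjc c).
Proof.
move=> e0 bnd.
have M0 : 0 <= M.
  by apply: le_trans (bnd 0 _); rewrite ?normc_ge0 // normc0 ltW.
(* Dividing by [K.+1] maps the unit disc into the disc of radius [e], which carries the bound over
   to the unit disc. *)
have [K eK] : exists K : nat, 1 <= K.+1%:R * e.
  exists (Num.bound e^-1); rewrite -ler_pdivrMr // mul1r.
  apply: ltW; apply: lt_le_trans (archi_boundP _) _; first by rewrite invr_ge0 ltW.
  by rewrite ler_nat.
have nnat (n : nat) : normc (n%:R : R[i]) = n%:R by rewrite normcMn normc1.
have bnd1 c : normc c <= 1 -> normc (h c) <= M *+ K.+1.
  move=> c1; have -> : c = (c / K.+1%:R) *+ K.+1.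
    by rewrite -[RHS]mulr_natr divfK ?pnatr_eq0.
  have -> n x : h (x *+ n) = h x *+ n.
    elim: n => [|n IH]; first by rewrite !mulr0n; apply: morph_add0.
    by rewrite !mulrS hD IH.
  rewrite normcMn lerMn2r /=; apply: bnd.
  rewrite normcM normcV nnat.
  by rewrite ler_pdivrMr ?ltr0Sn // (le_trans c1) // mulrC.
have hreal (r : R) : h (r%:C)%C = (r%:C)%C.
  (* [h] fixes integers, so [N (h r - r) = h s - s] with [s] the fractional part
     of [N r]; the right-hand side is bounded independently of [N]. *)
  apply/eqP; rewrite -subr_eq0; apply/eqP/eq0_normc; apply/eqP.
  rewrite eq_le normc_ge0 andbT leNgt; apply/negP => d0.
  set d := normc _ in d0.
  pose N := Num.bound ((M *+ K.+1 + 1) / d).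
  pose s := N%:R * r - (Num.floor (N%:R * r))%:~R.
  have s1 : `|s| <= 1.
    rewrite ger0_norm ?subr_ge0 ?floor_le //.
    rewrite lerBlDl; apply: ltW; have := floorD1_gt (N%:R * r).
    by rewrite intrD.
  have hs : h (s%:C)%C - (s%:C)%C = (h (r%:C)%C - (r%:C)%C) * N%:R.
    rewrite /s rmorphB rmorphM /= rmorph_nat rmorph_int (morph_addB hD) hM.
    rewrite field_hom_int -[N%:R]/(N%:Z%:~R) field_hom_int.
    by rewrite -pmulrn; ring.
  have : normc (h (s%:C)%C - (s%:C)%C) <= M *+ K.+1 + 1.
    apply: le_trans (le_normcD _ _) _; rewrite normcN normc_real lerD //.
    by apply: bnd1; rewrite normc_real.
  rewrite hs normcM -/d nnat.
  rewrite leNgt => /negP; apply; rewrite mulrC -ltr_pdivrMr //.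
  by apply: archi_boundP; rewrite divr_ge0 ?(ltW d0) // addr_ge0 // mulrn_wge0.
(* The square of [h 'i] is [-1], so [h 'i] is ['i] or its negative, and [h] is determined by
   [hreal]. *)
have := hM 'i%C 'i%C; rewrite -expr2 sqr_i (morph_addN hD) h1 => /esym/eqP.
rewrite -expr2 -sqr_i -subr_eq0 subr_sqr mulf_eq0 subr_eq0 addr_eq0.
move=> /orP[] /eqP hi; [left | right] => c.
  by rewrite [in LHS](complexE c) hD hM !hreal hi -complexE.
by rewrite [in LHS](complexE c) hD hM !hreal hi; case: c => a b; simpc.
Qed.

End FieldHom.

(** * The graph topology *)

(** Only the first [n] terms are constrained, so a single sequence can satisfy this for every [n];
    the vectors are not normalised. *)
Definition ortho (R : realType) (V : lmodType R[i]) (q : V -> V -> R[i])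
    n (e : nat -> V) :=
  (forall i, (i < n)%N -> e i != 0) /\
  (forall i j, (i < n)%N -> (j < n)%N -> i != j -> q (e i) (e j) = 0).

Lemma ortho_residue (R : realType) (V : lmodType R[i]) (q : V -> V -> R[i])
    n (e : nat -> V) x j :
  inner_product q -> ortho q n e -> (j < n)%N ->
  q (e j) (x - \sum_(i < n) (q (e i) x / q (e i) (e i)) *: e i) = 0.
Proof.
move=> hq [e0 eo] jn; rewrite (ipBr hq) (ip_sumr hq) (bigD1 (Ordinal jn)) //=.
rewrite (ipZr hq) divfK ?(ip_eq0 hq) ?e0 // big1 ?addr0 ?subrr // => i ij.
by rewrite (ipZr hq) (eo j i) ?mulr0 // eq_sym.
Qed.

Section DenseSubspace.
Variables (R : realType) (H : lmodType R[i]) (ip : H -> H -> R[i]).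
Variables (D : lmodType R[i]) (iota : D -> H).
Hypotheses (hH : is_hilbert ip) (hinf : infinite_dim H) (hD : is_dense_subspace ip iota).
Local Notation q := (ipD ip iota).
Implicit Types (x y z : D) (A : op D).

Lemma hilbert_ip : inner_product ip.
Proof. by case: hH. Qed.

Lemma iota_add : {morph iota : x y / x + y}.
Proof. by case: hD => l _ _ x y; have := l 1 x y; rewrite !scale1r. Qed.

Lemma iota_scale k x : iota (k *: x) = k *: iota x.
Proof.
by case: hD => l _ _; have := l k x 0; rewrite !addr0 (morph_add0 iota_add) addr0.
Qed.

Lemma ipD_inner : inner_product q.
Proof.
have hip := hilbert_ip; split=> [k x y z|x y|x|x].
- by rewrite /ipD iota_add iota_scale (ipDr hip) (ipZr hip).
- exact: (ip_conj hip).
- exact: (ip_ge0 hip).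
move=> /eqP; rewrite (ip_eq0 hip) => /eqP x0; case: hD => _ inj _.
by apply: inj; rewrite x0 (morph_add0 iota_add).
Qed.
Local Notation hq := ipD_inner.

(* Otherwise [D] is the span of the [e i], and a vector of [H] orthogonal to them
   is orthogonal to the dense subspace [D]. *)
Lemma ortho_extend n (e : nat -> D) : ortho q n e ->
  exists d, d != 0 /\ forall i, (i < n)%N -> q (e i) d = 0.
Proof.
move=> he; have hip := hilbert_ip; apply: contrapT => none.
have total d : (forall i, (i < n)%N -> q (e i) d = 0) -> d = 0.
  by move=> h; apply: contrapT => /eqP d0; apply: none; exists d.
have [x nx] := hinf (fun i : 'I_n => iota (e i)).
pose x' := x - \sum_(i < n) (ip (iota (e i)) x / q (e i) (e i)) *: iota (e i).
have x'0 : x' != 0 by rewrite subr_eq0; apply/eqP; apply: nx.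
have iota0 d : (iota d == 0) = (d == 0) by rewrite -(ip_eq0 hip) -(ip_eq0 hq).
have he' : ortho ip n (fun i => iota (e i)).
  by case: he => e0 eo; split=> // i /e0; rewrite iota0.
have ex' i : (i < n)%N -> ip (iota (e i)) x' = 0.
  exact: (@ortho_residue _ _ _ _ (fun i => iota (e i)) x i hip he').
have dx' d : ip (iota d) x' = 0.
  rewrite -[d](subrK (\sum_(i < n) (q (e i) d / q (e i) (e i)) *: e i)).
  rewrite [X in X + _]total => [|i]; last exact: (ortho_residue _ hq).
  rewrite add0r (morph_add_sum iota_add) (ip_conj hip) (ip_sumr hip) big1 ?conjc0 //.
  by move=> i _; rewrite iota_scale (ipZr hip) (ip_conj hip) ex' // conjc0 mulr0.
clearbody x'.
have N0 : 0 < normH ip x'.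
  rewrite lt_def normH_ge0 andbT; apply: contraNneq x'0 => N0.
  by rewrite -(ip_eq0 hip) (ip_self hip) N0 expr0n.
(* By Pythagoras no [d] is closer to [x'] than [0] is, against density. *)
have [_ _ dense] := hD; have [d] := dense x' _ N0; rewrite ltNge => /negP; apply.
rewrite -(ler_pXn2r (n := 2)) ?nnegrE ?normH_ge0 // !(normH_sqr hip).
rewrite (ipBr hip) !(ipBl hip) dx' (ip_conj hip (iota d) x') dx' conjc0 subr0 sub0r opprK.
by rewrite raddfD /= lerDl -(normH_sqr hip) sqr_ge0.
Qed.

Lemma ortho_sequence : exists e : nat -> D, forall n, ortho q n e.
Proof.
(* The choice function is total on lists: the implication admits the default [0] for lists that are
   not orthogonal. *)
have ext (s : seq D) : exists d, ortho q (size s) (nth 0 s) ->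
    d != 0 /\ forall i, (i < size s)%N -> q (nth 0 s i) d = 0.
  case: (pselect (ortho q (size s) (nth 0 s))) => [/ortho_extend[d hd]|no].
    by exists d.
  by exists 0.
have [step stepP] := choice ext.
pose s n := iter n (fun s => rcons s (step s)) [::].
pose e n := step (s n).
have sE n : s n = mkseq e n.
  by elim: n => // n IH; rewrite mkseqS -IH.
exists e; elim=> [|n IH]; first by split.
have sz : size (s n) = n by rewrite sE size_mkseq.
have nt i : (i < n)%N -> nth 0 (s n) i = e i by move=> ni; rewrite sE nth_mkseq.
have [|en0 en'] := stepP (s n).
  rewrite sz; case: IH => e0 eo; split=> [i ni|i j ni nj].
    by rewrite nt // e0.
  by rewrite !nt //; apply: eo.
have en i : (i < n)%N -> q (e i) (e n) = 0.
  by move=> ni; have := en' i; rewrite sz nt //; apply.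
case: IH => e0 eo; split=> [i|i j].
  by rewrite ltnS leq_eqVlt => /orP[/eqP->|/e0].
rewrite !ltnS (leq_eqVlt i) (leq_eqVlt j) => /orP[/eqP->|ni] /orP[/eqP->|nj].
- by rewrite eqxx.
- by move=> _; rewrite (ip_conj hq) en // conjc0.
- by move=> _; apply: en.
- exact: eo.
Qed.

(** Two nonzero orthogonal vectors cannot both lie on one line. *)
Lemma not_line_exists x : exists y, ~ line x y.
Proof.
have [e /(_ 2)[e0 eo]] := ortho_sequence.
case: (pselect (line x (e 0%N))) => [[k ek]|]; last by exists (e 0%N).
case: (pselect (line x (e 1%N))) => [[l el]|]; last by exists (e 1%N).
have := e0 0%N isT; have := e0 1%N isT; have := eo 0%N 1%N isT isT isT.
rewrite ek el (ipZl hq) (ipZr hq) => /eqP.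
rewrite !mulf_eq0 conjc_eq0 (ip_eq0 hq) !scaler_eq0.
by do 3 case: eqP.
Qed.

(** * Seminorms and convergent series for the graph topology *)

Definition seminorm (p : D -> R) :=
  [/\ forall x, 0 <= p x, forall x y, p (x + y) <= p x + p y &
      forall k x, p (k *: x) = normc k * p x].

Lemma seminormN p x : seminorm p -> p (- x) = p x.
Proof. by case=> _ _ pZ; rewrite -scaleN1r pZ normcN normc1 mul1r. Qed.

Lemma seminorm_sn A : in_Lplus ip iota A -> seminorm (sn ip iota A).
Proof.
move=> [lA _]; have hip := hilbert_ip.
have AD : {morph A : x y / x + y} by move=> x y; have := lA 1 x y; rewrite !scale1r.
split=> [x|x y|k x]; first exact: normH_ge0.
  by rewrite /sn AD iota_add; apply: normHD.
have := lA k x 0; rewrite /sn (morph_add0 AD) !addr0 => ->.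
by rewrite iota_scale normHZ.
Qed.

Lemma seminorm_sum n (As : 'I_n -> D -> R) (e : R) : 0 < e ->
  (forall i, seminorm (As i)) -> seminorm (fun x => e^-1 * \sum_i As i x).
Proof.
move=> e0 hA; have e1 : 0 <= e^-1 by rewrite invr_ge0 ltW.
split=> [x|x y|k x].
- by rewrite mulr_ge0 // sumr_ge0 // => i _; case: (hA i).
- rewrite -mulrDr ler_wpM2l // -big_split /= ler_sum // => i _.
  by case: (hA i).
rewrite mulrCA [normc k * _]mulr_sumr; congr (_ * _).
by apply: eq_bigr => i _; case: (hA i).
Qed.

Lemma in_Lplus_id : in_Lplus ip iota (fun x => x).
Proof. by split=> //; exists (fun x => x). Qed.

Hypothesis hF : is_Fspace ip iota.

(** The metric ball of radius [k.+1%:R^-1] at [0] contains the unit ball of some [p k], and each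
    ball of a graph seminorm, being open, contains such a metric ball. *)
Lemma countable_seminorms : exists p : nat -> D -> R,
  (forall k, seminorm (p k)) /\
  forall A, in_Lplus ip iota A -> forall e, 0 < e ->
    exists k, forall x, p k x < 1 -> sn ip iota A x < e.
Proof.
have [[d [[d0 dE dC dT] dt]] _] := hF.
have dxx x : d x x = 0 by apply/dE.
have ball k : exists p, seminorm p /\ forall x, p x < 1 -> d 0 x < k.+1%:R^-1.
  have : t_open ip iota (fun x => d 0 x < k.+1%:R^-1).
    apply/dt => x xk; exists (k.+1%:R^-1 - d 0 x); rewrite subr_gt0; split=> // y.
    by rewrite ltrBrDl; apply: le_lt_trans.
  move=> /(_ 0); rewrite dxx invr_gt0 ltr0Sn => /(_ isT)[n [As [e [e0 hA Ak]]]].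
  exists (fun x => e^-1 * \sum_i sn ip iota (As i) x); split.
    by apply: seminorm_sum => // i; apply: seminorm_sn.
  move=> x; rewrite mulrC ltr_pdivrMr // mul1r => xe; apply: Ak => i.
  rewrite subr0; apply: le_lt_trans xe.
  rewrite (bigD1 i) //= lerDl sumr_ge0 // => j _; exact: normH_ge0.
have [p hp] := choice ball; exists p; split=> [k|A hA e e0]; first by case: (hp k).
have [sn0 snD _] := seminorm_sn hA.
have : d_open d (fun x => sn ip iota A x < e).
  apply/dt => x xe; exists 1%N, (fun=> A), (e - sn ip iota A x).
  rewrite subr_gt0; split=> // y /(_ ord0); rewrite ltrBrDl; apply: le_lt_trans.
  by rewrite -[X in sn _ _ _ X <= _](subrKC x); apply: snD.
have A0 : sn ip iota A 0 = 0.
  case: (seminorm_sn hA) => _ _ /(_ 0 0).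
  by rewrite scale0r normc0 mul0r.
move=> /(_ 0); rewrite A0 => /(_ e0)[r [r0 hr]].
exists (Num.bound r^-1) => x /(proj2 (hp _)) xk; apply: hr; apply: lt_trans xk _.
rewrite invf_plt ?posrE ?ltr0Sn //; apply: lt_trans (archi_boundP _) _.
  by rewrite invr_ge0 ltW.
by rewrite ltr_nat.
Qed.

(** Each [u n] must be small only for the finitely many [p k] with [k <= n], which small scalars can
    achieve. Completeness gives a graph limit, and the identity operator turns it into a norm
    limit. *)
Lemma summable : exists p : nat -> D -> R,
  (forall k, seminorm (p k)) /\
  forall u : nat -> D, (forall k n, (k <= n)%N -> p k (u n) <= 2^-1 ^+ n.+1) ->
  exists l, forall e, 0 < e -> exists N, forall n, (N <= n)%N ->
    normH q (\sum_(i < n) u i - l) < e.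
Proof.
have [p [hp pA]] := countable_seminorms; exists p; split=> // u hu.
have [_ complete] := hF; pose S n := \sum_(i < n) u i.
(* The exponent [n.+1] in the hypothesis makes the geometric sum exactly this difference, which
   stays strictly below [1]. *)
have tail k m j : (k <= m)%N ->
    p k (S (m + j)%N - S m) <= 2^-1 ^+ m - 2^-1 ^+ (m + j).
  have [p0 pD pZ] := hp k; move=> km; elim: j => [|j IH].
    by rewrite addn0 !subrr -(scale0r 0) pZ normc0 mul0r.
  rewrite addnS {1}/S big_ord_recr /= -/(S _) addrAC.
  apply: le_trans (pD _ _) _; apply: le_trans (lerD IH (hu k _ _)) _.
    exact: leq_trans (leq_addr _ _).
  by rewrite exprS; lra.
have cauchy A : in_Lplus ip iota A -> forall e : R, 0 < e ->
    exists N, forall m n, (N <= m)%N -> (N <= n)%N -> sn ip iota A (S m - S n) < e.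
  move=> hA e e0; have [k pk] := pA A hA e e0; exists k.
  have half n : 0 < (2^-1 : R) ^+ n by rewrite exprn_gt0 // invr_gt0.
  have half1 n : (2^-1 : R) ^+ n <= 1.
    by rewrite exprn_ile1 // ?invr_ge0 // invf_le1 // ler1n.
  have main m n : (k <= m)%N -> (m <= n)%N -> p k (S n - S m) < 1.
    move=> km mn; have := tail k m (n - m)%N km; rewrite subnKC // => h.
    apply: le_lt_trans h _; have := half n; have := half1 m; lra.
  move=> m n km kn; apply: pk; case: (leqP m n) => mn.
    by rewrite -opprB (seminormN _ (hp k)); apply: main.
  by apply: main => //; apply: ltnW.
have [l hl] := complete S cauchy; exists l => e e0.
exact: (hl _ in_Lplus_id e e0).
Qed.

(** * Boundedness of [h] near [0] and its consequences for [A] *)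

Lemma pair_bounded A B h : semilinear_pair q A B h ->
  exists e M : R, 0 < e /\ forall k, normc k <= e -> normc (h k) <= M.
Proof.
move=> hAB; apply: contrapT => unbounded.
have large (e M : R) : 0 < e -> exists k, normc k <= e /\ M < normc (h k).
  move=> e0; apply: contrapT => /forallNP none; apply: unbounded.
  exists e, M; split=> // k ke; rewrite leNgt; apply/negP => Mk.
  by apply: (none k).
have [e he] := ortho_sequence; have [p [hp psum]] := summable.
have e0 n : q (e n) (e n) != 0 by rewrite (ip_eq0 hq); case: (he n.+1) => ->.
(* [y] is biorthogonal to [e], so pairing with [y n] extracts the coefficient [c n] of the
   series. *)
pose y n := (q (e n) (e n))^-1 *: e n.
(* A positive common bound of [p k (e n)] for [k <= n]; dividing by it makes the series summable. *)
pose t n := 1 + \sum_(k < n.+1) p k (e n).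
have t0 n : 0 < t n.
  by rewrite ltr_pwDl // sumr_ge0 // => k _; case: (hp k).
have pt k n : (k <= n)%N -> p k (e n) <= t n.
  move=> kn; rewrite /t (bigD1 (Ordinal (kn : (k < n.+1)%N))) //=.
  rewrite addrCA lerDl addr_ge0 // sumr_ge0 // => j _; by case: (hp j).
have step n : exists k, normc k <= 2^-1 ^+ n.+1 / t n /\
    n%:R * normH q (B (y n)) < normc (h k).
  by apply: large; rewrite divr_gt0 // exprn_gt0 // invr_gt0.
have [c hc] := choice step.
have [|l hl] := psum (fun n => c n *: e n).
  move=> k n kn; have [cn _] := hc n; have [p0 _ pZ] := hp k.
  rewrite pZ; move: cn; rewrite ler_pdivlMr //; apply: le_trans.
  by apply: ler_wpM2l; rewrite ?normc_ge0 // pt.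
have yl n : q (y n) l = c n.
  apply/eqP; rewrite -subr_eq0; apply/eqP/eq0_normc/eqP.
  rewrite eq_le normc_ge0 andbT leNgt; apply/negP.
  set d := normc _ => d0.
  have N1 : 0 < 1 + normH q (y n) by rewrite ltr_pwDl // normH_ge0.
  have [N hN] := hl _ (divr_gt0 d0 N1).
  (* The index [N + n.+1] is at least [N] and exceeds [n], so the partial sum contains the term
     [c n *: e n]. *)
  have {hN} := hN (N + n.+1)%N (leq_addr _ _).
  set S := \sum_(i < _) _ => hS.
  have yS : q (y n) S = c n.
    have nN : (n < N + n.+1)%N by rewrite addnS ltnS leq_addl.
    rewrite (ip_sumr hq) (bigD1 (Ordinal nN)) //= big1 => [|i iN].
      rewrite addr0 (ipZr hq) (ipZl hq) conjc_inv -(ip_conj hq) mulVf ?mulr1 //.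
    have [_ eo] := he (N + n.+1)%N.
    by rewrite (ipZr hq) (ipZl hq) (eo n i) ?mulr0 // eq_sym.
  have : d <= normH q (y n) * normH q (S - l).
    rewrite /d -normcN opprB -[in c n - _]yS -(ipBr hq).
    exact: (cauchy_schwarz hq).
  rewrite leNgt => /negP; apply.
  move: hS; rewrite ltr_pdivlMr // mulrDr mulr1 mulrC.
  by apply: le_lt_trans; rewrite lerDr normH_ge0.
(* With [n] above the norm of [A l], Cauchy-Schwarz bounds [h (c n)] by [n] times the norm of
   [B (y n)], against the choice of [c n]. *)
pose n := Num.bound (normH q (A l)).
have [_] := hc n; rewrite ltNge => /negP; apply.
rewrite -yl -(pair_ip hAB) mulrC.
apply: le_trans (cauchy_schwarz hq _ _) _.
apply: ler_wpM2l; first exact: normH_ge0.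
exact/ltW/archi_boundP/normH_ge0.
Qed.

Lemma pair_linear A B h : semilinear_pair q A B h ->
  linear_op A \/ antilinear_op A.
Proof.
move=> hAB; have [e [M [e0 bnd]]] := pair_bounded hAB.
case: (bounded_field_hom (pair_hD hAB) (pair_hM hAB) (pair_h1 hAB) e0 bnd) => hE.
  by left=> k x y; rewrite (pair_AD hAB) (pair_AZ hAB) hE.
by right=> k x y; rewrite (pair_AD hAB) (pair_AZ hAB) hE.
Qed.

Lemma pair_in_Lplus A B h : semilinear_pair q A B h ->
  linear_op A -> in_Lplus ip iota A.
Proof.
move=> hAB lA; split=> //.
have [x nx] := not_line_exists 0; have x0 := notline_neq0 nx.
have A0 := morph_add0 (pair_AD hAB).
have Ax0 : A x != 0.
  by apply: contraNneq x0 => e; apply/eqP/(pair_Ainj hAB); rewrite e A0.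
(* Linearity and semilinearity of [A], compared at one [x] with [A x] nonzero, force [h] to be the
   identity. *)
have hE k : h k = k.
  have := lA k x 0; rewrite A0 !addr0 (pair_AZ hAB) => e.
  have /eqP : (h k - k) *: A x = 0 by rewrite scalerBl e subrr.
  by rewrite scaler_eq0 (negbTE Ax0) orbF subr_eq0 => /eqP.
have [Bi hB] := choice (pair_Bsurj hAB).
by exists Bi => phi psi; rewrite -{2}(hB phi) (pair_ip hAB) hE.
Qed.

Lemma pair_inverse A B h : semilinear_pair q A B h ->
  exists Ainv, cancel A Ainv /\ cancel Ainv A.
Proof.
move=> hAB; have [Ai hA] := choice (pair_Asurj hAB).
by exists Ai; split=> // x; apply: (pair_Ainj hAB).
Qed.

(** The scalar [q (b i) x] leaves [A] as its image under [h], which is the pairing supplied by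
    [pair_ip]. *)
Lemma pair_conjugate A B h n (a b : 'I_n -> D) x : semilinear_pair q A B h ->
  \sum_i dyad q (A (a i)) (B (b i)) (A x) = A (\sum_i dyad q (a i) (b i) x).
Proof.
move=> hAB; rewrite (morph_add_sum (pair_AD hAB)); apply: eq_bigr => i _.
by rewrite /dyad (pair_ip hAB) (pair_AZ hAB).
Qed.

(** * Finite-rank operators as sums of dyads *)

Lemma in_F_dyads T : in_F ip iota T <->
  exists n (a b : 'I_n -> D), T = fun x => \sum_i dyad q (a i) (b i) x.
Proof.
split=> [[n [c [a [b ->]]]]|[n [a [b ->]]]].
  exists n, (fun i => c i *: a i), b; apply/funext => x; apply: eq_bigr => i _.
  by rewrite /dyad /tens !scalerA mulrC.
exists n, (fun=> 1), a, b; apply/funext => x; apply: eq_bigr => i _.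
by rewrite scale1r.
Qed.

Lemma in_F_dyad a b : in_F ip iota (dyad q a b).
Proof.
apply/in_F_dyads; exists 1%N, (fun=> a), (fun=> b).
by apply/funext => x; rewrite big_ord1.
Qed.

Lemma dyad_rank1_proj a b : q b a = 1 -> rank1_proj ip iota (dyad q a b).
Proof.
move=> ba; split=> [|x||].
- exact: in_F_dyad.
- by rewrite /dyad (ipZr hq) ba mulr1.
- by exists a; rewrite /dyad ba scale1r; apply/eqP; apply: (ip1_neq0 hq ba).
by exists a => x; exists (q b x).
Qed.

Lemma rank1_proj_dyad P : rank1_proj ip iota P ->
  exists u v, q v u = 1 /\ P = dyad q u v.
Proof.
move=> [/in_F_dyads[n [a [b PE]]] PP [x0 Px0] [u Pu]].
have u0 : u != 0.
  by apply/eqP => u0; apply: Px0; have [k ->] := Pu x0; rewrite u0 scaler0.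
have [z uz] := ip_normalize hq u0.
have zu : q z u = 1 by rewrite (ip_conj hq) uz conjc1.
(* This is the adjoint of [P] applied to [z], so [q v x = q z (P x)] is the coefficient of [P x]
   along [u]. *)
pose v := \sum_i q (a i) z *: b i.
have Pv : P = dyad q u v.
  apply/funext => x; have [k Pk] := Pu x.
  rewrite Pk; congr (_ *: _).
  have -> : k = q z (P x) by rewrite Pk (ipZr hq) zu mulr1.
  rewrite PE (ip_sumr hq) (ip_conj hq) (ip_sumr hq) rmorph_sum /=.
  apply: eq_bigr => i _; rewrite /dyad !(ipZr hq) rmorphM /= -!(ip_conj hq).
  by rewrite mulrC.
exists u, v; split=> //.
have vx0 : q v x0 != 0.
  by apply/eqP => e; apply: Px0; rewrite Pv /dyad e scale0r.
have /eqP := PP x0; rewrite Pv /dyad (ipZr hq) -subr_eq0 -scalerBl scaler_eq0.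
by rewrite (negbTE u0) orbF subr_eq0 => /eqP /(canRL (mulKf vx0)) ->; rewrite mulVf.
Qed.

Section Map.
Variable Phi : op D -> op D.
Hypothesis Phi_add : forall S T, in_F ip iota S -> in_F ip iota T ->
  Phi (op_add S T) = op_add (Phi S) (Phi T).

Lemma Phi_dyads n (a b : 'I_n -> D) x :
  Phi (fun x => \sum_i dyad q (a i) (b i) x) x = \sum_i Phi (dyad q (a i) (b i)) x.
Proof.
elim: n a b x => [|n IH] a b x.
  rewrite big_ord0.
  (* Additivity of [Phi] is given for pairs only; the empty sum [Z] is handled through
     [Z + Z = Z]. *)
  have F0 : in_F ip iota (fun x => \sum_(i < 0) dyad q (a i) (b i) x).
    by apply/in_F_dyads; exists 0%N, a, b.
  have := congr1 (@^~ x) (Phi_add F0 F0); rewrite /op_add.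
  rewrite [X in Phi X _ = _](_ : _ = fun x => \sum_(i < 0) dyad q (a i) (b i) x).
    by rewrite -[LHS]addr0 => /addrI/esym.
  by apply/funext => ?; rewrite !big_ord0 addr0.
rewrite big_ord_recr -IH /=.
rewrite (_ : (fun x => _) = op_add (fun x => \sum_(i < n)
   dyad q (a (widen_ord (leqnSn n) i)) (b (widen_ord (leqnSn n) i)) x)
   (dyad q (a ord_max) (b ord_max))); last first.
  by apply/funext => z; rewrite big_ord_recr.
rewrite Phi_add //; last exact: in_F_dyad.
by apply/in_F_dyads; do 3 eexists.
Qed.

Hypothesis Phi_surj : forall T', in_F ip iota T' ->
  exists T, in_F ip iota T /\ Phi T = T'.
Hypothesis Phi_proj : forall P, rank1_proj ip iota P ->
  rank1_proj ip iota (Phi P) /\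
  forall c : R[i], exists d : R[i], Phi (op_scale c P) = op_scale d (Phi P).

Lemma Phi_preserver : preserver q (fun x y => Phi (dyad q x y)).
Proof.
split=> [x x' y z|x y y' z|k x y|x y yx|k x y yx|a b].
- by rewrite -(dyadDl q) Phi_add //; apply: in_F_dyad.
- by rewrite -(dyadDr hq) Phi_add //; apply: in_F_dyad.
- by rewrite (dyadZ hq).
- by have [/rank1_proj_dyad] := Phi_proj (dyad_rank1_proj yx).
- have [_ /(_ k)[d e]] := Phi_proj (dyad_rank1_proj yx); exists d => z.
  rewrite -[RHS]/(op_scale d (Phi (dyad q x y)) z) -e; congr (Phi _ z).
  by apply/funext => w; rewrite /op_scale /dyad !scalerA mulrC.
have [T [/in_F_dyads[n [x [y ->]]] e]] := Phi_surj (in_F_dyad a b).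
by exists n, x, y => z; rewrite -e Phi_dyads.
Qed.

End Map.
End DenseSubspace.

(** * The two normal forms of [Phi] *)

Theorem theorem1p2 (R : realType) (H : lmodType R[i]) (ip : H -> H -> R[i])
  (hH : is_hilbert ip) (hinf : infinite_dim H)
  (D : lmodType R[i]) (iota : D -> H) (hD : is_dense_subspace ip iota)
  (hF : is_Fspace ip iota)
  (Phi : op D -> op D)
  (Phi_F : forall T, in_F ip iota T -> in_F ip iota (Phi T))
  (Phi_add : forall S T, in_F ip iota S -> in_F ip iota T ->
     Phi (op_add S T) = op_add (Phi S) (Phi T))
  (Phi_surj : forall T', in_F ip iota T' -> exists T, in_F ip iota T /\ Phi T = T')
  (Phi_proj : forall P, rank1_proj ip iota P ->
     rank1_proj ip iota (Phi P) /\
     forall c : R[i], exists d : R[i], Phi (op_scale c P) = op_scale d (Phi P)) :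
  (exists A Ainv : op D,
     [/\ cancel A Ainv, cancel Ainv A,
         linear_op A \/ antilinear_op A,
         (linear_op A -> in_Lplus ip iota A) &
         forall T, in_F ip iota T -> Phi T = (fun x => A (T (Ainv x)))])
  \/
  (exists Cop Cinv : op D,
     [/\ cancel Cop Cinv, cancel Cinv Cop,
         linear_op Cop \/ antilinear_op Cop,
         (linear_op Cop -> in_Lplus ip iota Cop) &
         forall T Tp, in_F ip iota T -> is_plus ip iota T Tp ->
           Phi T = (fun x => Cop (Tp (Cinv x)))]).
Proof.
have hq := ipD_inner hH hD.
have dim2 := not_line_exists hH hinf hD.
have ht := Phi_preserver hH hD Phi_add Phi_surj Phi_proj.
case: (tau_tensor hq dim2 ht) => -[A [B AB]]; [left | right].
  have [h hAB] := preserver_pair hq dim2 ht AB.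
  have [Ainv [AK KA]] := pair_inverse hAB; exists A, Ainv; split=> //.
  - exact: (pair_linear hH hinf hD hF hAB).
  - exact: (pair_in_Lplus hH hinf hD hAB).
  move=> T /in_F_dyads[n [a [b ->]]]; apply/funext => x.
  rewrite (Phi_dyads Phi_add) -[x in LHS]KA -(pair_conjugate _ _ _ hAB).
  by apply: eq_bigr => i _; rewrite AB.
(* With the arguments of [tau] exchanged, [B] becomes the semilinear map and [A] its partner, so [B]
   is the conjugating operator. *)
have [h hBA] := preserver_pair hq dim2 (preserver_swap hq ht) (fun x y => AB y x).
have [Binv [BK KB]] := pair_inverse hBA; exists B, Binv; split=> //.
- exact: (pair_linear hH hinf hD hF hBA).
- exact: (pair_in_Lplus hH hinf hD hBA).
move=> T Tp /in_F_dyads[n [a [b ->]]] hTp.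
(* [is_plus] determines [Tp], and the adjoint of a sum of dyads has the factors of each dyad
   swapped. *)
have TpE x : Tp x = \sum_i dyad (ipD ip iota) (b i) (a i) x.
  apply: (ip_inj hq) => y; rewrite hTp (ip_sumr hq) [RHS](ip_conj hq) (ip_sumr hq).
  by rewrite rmorph_sum; apply: eq_bigr => i _; apply: (dyad_adj hq).
apply/funext => x.
rewrite (Phi_dyads Phi_add) -[x in LHS]KB TpE -(pair_conjugate _ _ _ hBA).
by apply: eq_bigr => i _; rewrite AB.
Qed.
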